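(* There is an algorithm that, given a finite simple graph $G$ on $n$ vertices, decides in time $\mathcal{O}(n^8)$ whether $G$ is a Maya-Tupi graph, and that outputs an MT-partition of $G$ when one exists.
   Context: All graphs are finite and simple. A graph $G$ is Maya-Tupi if its vertex set can be partitioned into two (possibly empty) sets $A$ and $B$ such that $\delta(G[A])\ge |A|-2$ (every vertex of $A$ is non-adjacent to at most one other vertex of $A$) and $\Delta(G[B])\le 1$. Such a pair $(A,B)$ is called an MT-partition of $G$. *)

(* Defs.v *)
From mathcomp Require Import all_boot.

Set Implicit Arguments.
Unset Strict Implicit.
Unset Printing Implicit Defensive.

(** * Maya-Tupi graphs *)

Section MayaTupi.
Variables (V : finType) (e : rel V).

Definition deg_in (S : {set V}) (v : V) : nat := #|[set u in S | e v u]|.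

(* Truncated subtraction is harmless here, since degrees are nonnegative.
   Both degree conditions hold vacuously on an empty part.  The predicate
   [partition] of finset is not used because it excludes empty parts. *)
Definition MT_partition (A B : {set V}) : bool :=
  [&& A :|: B == [set: V],
      [disjoint A & B],
      [forall v in A, #|A| - 2 <= deg_in A v]
    & [forall v in B, deg_in B v <= 1]].

Definition maya_tupi : Prop := exists A B : {set V}, MT_partition A B.

End MayaTupi.

(** * Word RAM

   A machine has registers, named directly by the instructions, and a memory
   that is addressed indirectly through registers.  Constants and sums
   are reduced modulo [2 ^ w], where [w] is the word length; the other
   instructions cannot leave the range of a word.  There is no multiplication or
   bitwise instruction, and every instruction takes one unit of time. *)

Inductive instr : Type :=
| Const of nat & nat         (* Const d k : r_d := k *)
| Add of nat & nat & nat     (* Add d a b : r_d := r_a + r_b *)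
| Sub of nat & nat & nat     (* Sub d a b : r_d := max (r_a - r_b) 0 *)
| Read of nat & nat          (* Read d a  : r_d := mem[r_a] *)
| Write of nat & nat         (* Write a b : mem[r_a] := r_b *)
| Jump of nat                (* Jump l    : goto l *)
| JumpZ of nat & nat.        (* JumpZ a l : if r_a = 0 then goto l *)

Definition program := seq instr.

Record config := Config { pc : nat; reg : nat -> nat; mem : nat -> nat }.

Definition upd (f : nat -> nat) (d x : nat) : nat -> nat :=
  fun i => if i == d then x else f i.

Definition exec_instr (w : nat) (i : instr) (c : config) : config :=
  let: Config p r m := c in
  match i with
  | Const d k   => Config p.+1 (upd r d (k %% 2 ^ w)) m
  | Add d a b   => Config p.+1 (upd r d ((r a + r b) %% 2 ^ w)) m
  | Sub d a b   => Config p.+1 (upd r d (r a - r b)) m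
  | Read d a    => Config p.+1 (upd r d (m (r a))) m
  | Write a b   => Config p.+1 r (upd m (r a) (r b))
  | Jump l      => Config l r m
  | JumpZ a l   => Config (if r a == 0 then l else p.+1) r m
  end.

(* The machine halts by leaving the program; a halted configuration is a fixed
   point of [step]. *)
Definition halted (P : program) (c : config) : bool := size P <= pc c.

Definition step (w : nat) (P : program) (c : config) : config :=
  if onth P (pc c) is Some i then exec_instr w i c else c.

(* Because halted configurations do not move, [halted P (run w P t c)] says
   that the computation from [c] takes at most [t] steps, and [run w P t c] is
   then its final configuration. *)
Definition run (w : nat) (P : program) (t : nat) (c : config) : config :=
  iter t (step w P) c.

(** * Graph input and partition output *)

(* r_0 holds the number of vertices, and the memory starts with the adjacency
   matrix in row-major order; everything else is zero. *)
Definition graph_input (n : nat) (e : rel 'I_n) : config :=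
  Config 0
    (upd (fun=> 0) 0 n)
    (fun a => nat_of_bool
       [exists i : 'I_n, exists j : 'I_n, (a == i * n + j) && e i j]).

Definition out_class (n : nat) (c : config) (k : nat) : {set 'I_n} :=
  [set v : 'I_n | mem c v == k].

(* The answer is in r_0.  For a positive answer, cell [v] of the memory holds
   1 if the vertex [v] is in [A] and 0 if it is in [B]. *)
Definition MT_output (n : nat) (e : rel 'I_n) (c : config) : Prop :=
  [/\ maya_tupi e -> reg c 0 = 1,
      ~ maya_tupi e -> reg c 0 = 0
    & maya_tupi e -> MT_partition e (out_class n c 1) (out_class n c 0)].

(* Word length [k] times the bit length of [n], with [k] fixed: words have
   [O(log n)] bits. *)
Definition word_length (k n : nat) : nat := k * (trunc_log 2 n).+1.

Definition bigO (T f : nat -> nat) : Prop :=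
  exists C N : nat, forall n : nat, N <= n -> T n <= C * f n.

(* Main.v *)
Require Import Defs.
From mathcomp Require Import all_boot.
From mathcomp Require Import zify.

Set Implicit Arguments.
Unset Strict Implicit.
Unset Printing Implicit Defensive.

(* Two MT-partitions (A, B) and (A', B') of a graph satisfy |A :&: B'| <= 2 and
   |B :&: A'| <= 2.  Hence, if G is Maya-Tupi, an MT-partition of the subgraph
   induced by the first i vertices becomes one of the subgraph induced by the
   first i + 1 vertices after at most 4 of the old vertices have changed sides
   and the new vertex has been put on the right side: 5 flips at most.  Each of
   the n stages tries all 5-tuples of flips and checks each outcome in
   quadratic time, hence the exponent 8. *)

(** * Labellings *)

Definition flip (L : nat -> bool) (a : nat) : nat -> bool :=
  fun u => L u (+) (u == a).

Definition flips (L : nat -> bool) (s : seq nat) : nat -> bool :=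
  foldl flip L s.

Lemma flipsE L s u : flips L s u = L u (+) odd (count_mem u s).
Proof.
elim: s L => [|a s IH] L /=; first by rewrite addbF.
by rewrite IH oddD oddb /flip eq_sym addbA.
Qed.

Section Labelling.
Variable E : rel nat.

(* The label [true] stands for A and [false] for B. *)
Definition bad (L : nat -> bool) (v u : nat) : bool :=
  [&& v != u, L v == L u & E v u != L v].

(** One bound serves both degree conditions: within the part of [v], a bad partner is a
    non-neighbour if [v] is in A and a neighbour if [v] is in B. *)
Definition valid (i : nat) (L : nat -> bool) : bool :=
  all (fun v => count (bad L v) (iota 0 i) <= 1) (iota 0 i).

Lemma eq_valid i L L' :
  (forall u, u < i -> L u = L' u) -> valid i L = valid i L'.
Proof.
move=> eqL; apply: eq_in_all => v; rewrite mem_iota => /andP[_ lt_vi].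
congr (_ <= _); apply: eq_in_count => u; rewrite mem_iota => /andP[_ lt_ui].
by rewrite /bad !eqL.
Qed.

Lemma sub_valid i j L : i <= j -> valid j L -> valid i L.
Proof.
move=> le_ij /allP vj; apply/allP => v; rewrite mem_iota => /andP[_ lt_vi].
apply: leq_trans (vj v _); last by rewrite mem_iota /=; lia.
by rewrite -(subnKC le_ij) iotaD count_cat leq_addr.
Qed.

Lemma valid_bad2 i L a b c :
  valid i L -> a < i -> b < i -> c < i -> b != c ->
  ~~ (bad L a b && bad L a c).
Proof.
move=> /allP vi lt_ai lt_bi lt_ci neq_bc; apply/negP => /andP[ab ac].
have /vi : a \in iota 0 i by rewrite mem_iota.
rewrite leqNgt => /negP; apply; rewrite -size_filter.
apply: (@uniq_leq_size _ [:: b; c]); first by rewrite /= inE neq_bc.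
by move=> x; rewrite !inE mem_filter mem_iota => /orP[]/eqP->; apply/andP.
Qed.

Hypothesis E_sym : symmetric E.

(* On three vertices which move from one part to the other, every vertex would
   have exactly one neighbour: impossible by parity. *)
Lemma moved_le2 i L L' x : valid i L -> valid i L' ->
  count (fun u => (L u == x) && (L' u == ~~ x)) (iota 0 i) <= 2.
Proof.
move=> vL vL'; rewrite -size_filter leqNgt; apply/negP.
set S := filter _ _ => S_gt2.
have uS : uniq S by rewrite filter_uniq ?iota_uniq.
have {}inS u : u \in S -> [/\ u < i, L u = x & L' u = ~~ x].
  by rewrite mem_filter mem_iota => /andP[/andP[/eqP-> /eqP->]].
case: S S_gt2 uS inS => [|a [|b [|c S]]] //= _ uS inS.
have /inS[ai La L'a] : a \in [:: a, b, c & S] by rewrite !inE eqxx.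
have /inS[bi Lb L'b] : b \in [:: a, b, c & S] by rewrite !inE eqxx !orbT.
have /inS[ci Lc L'c] : c \in [:: a, b, c & S] by rewrite !inE eqxx !orbT.
move: uS; rewrite !inE !negb_or -!andbA => /and5P[ab ac _ bc _].
have := (valid_bad2 vL ai bi ci bc, valid_bad2 vL' ai bi ci bc,
  valid_bad2 vL bi ai ci ac, valid_bad2 vL' bi ai ci ac,
  valid_bad2 vL ci ai bi ab, valid_bad2 vL' ci ai bi ab).
rewrite /bad La Lb Lc L'a L'b L'c !eqxx ![_ == a]eq_sym [c == b]eq_sym.
rewrite ab ac bc (E_sym b a) (E_sym c a) (E_sym c b) /=.
by case: x {inS La Lb Lc L'a L'b L'c}; case: (E a b); case: (E a c);
  case: (E b c); case=> [[[[[? ?] ?] ?] ?] ?].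
Qed.

(** A labelling valid on all [n] vertices stays valid on the first [i.+1], and flipping [L] exactly
    where the two differ turns [L] into it there. *)
Lemma valid_extend n i L : i < n -> valid i L -> (exists L', valid n L') ->
  exists s, [/\ size s = 5, all (fun a => a <= n) s & valid i.+1 (flips L s)].
Proof.
move=> lt_in vL [L' vL'].
have vL'i : valid i L' by apply: sub_valid vL'; exact: ltnW.
pose D := [seq u <- iota 0 i.+1 | L u != L' u].
have sizeD : size D <= 5.
  rewrite size_filter -addn1 iotaD count_cat add0n /=.
  rewrite -[5]/(4 + 1); apply: leq_add; last by case: (_ != _).
  apply: leq_trans (leq_add (moved_le2 true vL vL'i) (moved_le2 false vL vL'i)).
  by rewrite -count_predUI; apply: leq_trans (leq_addr _ _);
    apply: sub_count => u /=; case: (L u); case: (L' u).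
(* Padding to length exactly 5 uses the index [n], which lies beyond the vertices up to [i] and so
   leaves their labels unchanged. *)
exists (D ++ nseq (5 - size D) n); split.
- by rewrite size_cat size_nseq subnKC.
- rewrite all_cat all_nseq leqnn orbT andbT; apply/allP => u.
  by rewrite mem_filter mem_iota => /andP[_]; lia.
- rewrite (@eq_valid _ _ L') ?(sub_valid lt_in) // => u lt_ui.
  rewrite flipsE count_cat count_nseq /= (_ : n == u = false) ?addn0; last lia.
  rewrite count_uniq_mem ?filter_uniq ?iota_uniq // mem_filter mem_iota /=.
  by rewrite add0n lt_ui andbT oddb; case: (L u); case: (L' u).
Qed.

End Labelling.

(** * Structured programs *)

Inductive cmd : Type :=
| Skip
| Op of instr
| Seq of cmd & cmd
| If of nat & cmd & cmd
| While of nat & cmd.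

Notation "c1 ;; c2" := (Seq c1 c2) (at level 100, right associativity).

Fixpoint len (c : cmd) : nat :=
  match c with
  | Skip => 0
  | Op _ => 1
  | Seq c1 c2 => len c1 + len c2
  | If _ c1 c2 => (len c1 + (len c2).+1).+1
  | While _ c1 => (len c1).+2
  end.

(** The load address [l] is a parameter because jump targets are absolute. *)
Fixpoint compile (l : nat) (c : cmd) : program :=
  match c with
  | Skip => [::]
  | Op i => [:: i]
  | Seq c1 c2 => compile l c1 ++ compile (l + len c1) c2
  | If x c1 c2 =>
      JumpZ x (l.+1 + len c1).+1 :: compile l.+1 c1 ++
      Jump ((l.+1 + len c1).+1 + len c2) :: compile (l.+1 + len c1).+1 c2
  | While x c1 =>
      JumpZ x (l.+1 + len c1).+1 :: compile l.+1 c1 ++ [:: Jump l]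
  end.

Fixpoint mods (c : cmd) : seq nat :=
  match c with
  | Skip => [::]
  | Op (Const d _) | Op (Add d _ _) | Op (Defs.Sub d _ _) | Op (Read d _) => [:: d]
  | Op _ => [::]
  | Seq c1 c2 | If _ c1 c2 => mods c1 ++ mods c2
  | While _ c1 => mods c1
  end.

Definition basic (i : instr) : bool :=
  match i with Jump _ | JumpZ _ _ => false | _ => true end.

(* Register 1 holds 0 and register 2 holds 1. *)
Definition For (x b : nat) (c : cmd) : cmd :=
  Op (Defs.Sub x b 1);; While x (Op (Defs.Sub x x 2);; c).

(** * Position of compiled code inside a program *)

Lemma size_compile l c : size (compile l c) = len c.
Proof.
elim: c l => //= [c1 IH1 c2 IH2|_ c1 IH1 c2 IH2|_ c1 IH1] l;
  by rewrite !size_cat /= ?IH1 ?IH2 ?addn1.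
Qed.

Definition code_at (P : program) (l : nat) (Q : program) : Prop :=
  exists P1 P2, P = P1 ++ Q ++ P2 /\ size P1 = l.

Lemma code_at_cat P l Q1 Q2 :
  code_at P l (Q1 ++ Q2) -> code_at P l Q1 /\ code_at P (l + size Q1) Q2.
Proof.
move=> [P1 [P2 [-> <-]]]; split.
  by exists P1, (Q2 ++ P2); rewrite !catA.
by exists (P1 ++ Q1), P2; rewrite !catA size_cat.
Qed.

Lemma code_at_cons P l i Q :
  code_at P l (i :: Q) -> onth P l = Some i /\ code_at P l.+1 Q.
Proof.
move=> [P1 [P2 [-> <-]]]; split; last first.
  by exists (rcons P1 i), P2; rewrite cat_rcons size_rcons.
by elim: P1.
Qed.

Definition agree (ds : seq nat) (r r' : nat -> nat) : Prop :=
  forall y, y \notin ds -> r' y = r y.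

Lemma agree_sub ds ds' r r' :
  {subset ds <= ds'} -> agree ds r r' -> agree ds' r r'.
Proof. by move=> sub A y y_ds'; apply: A; apply: contra y_ds' => /sub. Qed.

Lemma agree_trans ds r1 r2 r3 :
  agree ds r1 r2 -> agree ds r2 r3 -> agree ds r1 r3.
Proof. by move=> A B y y_ds; rewrite B ?A. Qed.

Lemma agree_upd (ds : seq nat) r r' d x :
  d \in ds -> agree ds r r' -> agree ds r (upd r' d x).
Proof.
by move=> dds A y yds; rewrite /upd; case: eqP yds => [->|_ /A //]; rewrite dds.
Qed.

Local Arguments run : simpl never.

(** * Proof rules for total correctness with a time bound *)

Section Wp.
Variable w : nat.

(** Quantifying over the surrounding program and the load address makes this composable; the step
    count is exact so that consecutive runs can be concatenated. *)
Definition runs c t r m r' m' : Prop :=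
  forall P l, code_at P l (compile l c) ->
    run w P t (Config l r m) = Config (l + len c) r' m'.

(* The frame condition on registers is built in, so that loop invariants need
   not list the registers which the body leaves alone. *)
Definition wp c T (Q : (nat -> nat) -> (nat -> nat) -> Prop) r m : Prop :=
  exists t r' m',
    [/\ t <= T, runs c t r m r' m', agree (mods c) r r' & Q r' m'].

Lemma run_add P s t c : run w P (s + t) c = run w P t (run w P s c).
Proof. by rewrite /run addnC iterD. Qed.

Lemma run_halted P t c : halted P c -> run w P t c = c.
Proof.
move=> haltc; elim: t => // t IH; rewrite /run iterS -/(run w P t c) IH /step.
by rewrite onth_default.
Qed.

Lemma run_step P t l r m i : onth P l = Some i ->
  run w P t.+1 (Config l r m) = run w P t (exec_instr w i (Config l r m)).
Proof. by move=> Pl; rewrite /run iterSr /step /= Pl. Qed.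

Lemma wp_weaken c T T' (Q Q' : _ -> _ -> Prop) r m : wp c T Q r m -> T <= T' ->
  (forall r' m', agree (mods c) r r' -> Q r' m' -> Q' r' m') -> wp c T' Q' r m.
Proof.
move=> [t [r' [m' [le_tT R A q]]]] le_TT' QQ'.
by exists t, r', m'; split=> //; [exact: leq_trans le_TT'|exact: QQ'].
Qed.

Lemma wp_skip T (Q : _ -> _ -> Prop) r m : Q r m -> wp Skip T Q r m.
Proof. by move=> q; exists 0, r, m; split=> // P l _; rewrite /run addn0. Qed.

Lemma wp_op i T (Q : _ -> _ -> Prop) r m : basic i ->
  (let c := exec_instr w i (Config 0 r m) in Q (reg c) (Defs.mem c)) ->
  wp (Op i) T.+1 Q r m.
Proof.
move=> bi q; set c := exec_instr w i (Config 0 r m) in q.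
exists 1, (reg c), (Defs.mem c); split=> //.
  move=> P l /code_at_cons[Pl _]; rewrite (run_step _ _ _ Pl) addn1.
  by case: i bi @c {q Pl}.
by case: i bi @c {q} => //= [d k|d a b|d a b|d a] _; apply: agree_upd;
  rewrite ?inE.
Qed.

Lemma wp_seq T1 T2 c1 c2 T (Q : _ -> _ -> Prop) r m :
  wp c1 T1 (wp c2 T2 Q) r m -> T1 + T2 <= T -> wp (Seq c1 c2) T Q r m.
Proof.
move=> [t1 [r1 [m1 [le1 R1 A1 [t2 [r2 [m2 [le2 R2 A2 q]]]]]]]] leT.
exists (t1 + t2), r2, m2; split=> //; first by lia.
  move=> P l /= /code_at_cat[]; rewrite size_compile => C1 C2.
  by rewrite run_add (R1 _ _ C1) (R2 _ _ C2) addnA.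
apply: agree_trans; [apply: agree_sub A1|apply: agree_sub A2];
  by move=> y; rewrite /= mem_cat => ->; rewrite ?orbT.
Qed.

Lemma wp_opseq i c T (Q : _ -> _ -> Prop) r m : basic i ->
  (let s := exec_instr w i (Config 0 r m) in wp c T Q (reg s) (Defs.mem s)) ->
  wp (Seq (Op i) c) T.+1 Q r m.
Proof. by move=> bi q; apply: (@wp_seq 1 T) => //; apply: wp_op. Qed.

(** The extra 2 pays for the test and, after the first branch, for the jump over the second. *)
Lemma wp_if x c1 c2 T (Q : _ -> _ -> Prop) r m :
  (r x != 0 -> wp c1 T Q r m) -> (r x = 0 -> wp c2 T Q r m) ->
  wp (If x c1 c2) T.+2 Q r m.
Proof.
move=> W1 W2; have [rx|rx] := eqVneq (r x) 0.
  have [t [r' [m' [leT R A q]]]] := W2 rx.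
  exists t.+1, r', m'; split=> //; first by lia.
    move=> P l /= /code_at_cons[Pl /code_at_cat[_ /code_at_cons[_]]].
    rewrite size_compile => C.
    rewrite (run_step _ _ _ Pl) /= rx /=.
    by rewrite (R _ _ C); congr Config; lia.
  by apply: agree_sub A => y; rewrite /= mem_cat => ->; rewrite orbT.
have [t [r' [m' [leT R A q]]]] := W1 rx.
exists (t.+1 + 1), r', m'; split=> //; first by lia.
  move=> P l /= /code_at_cons[Pl /code_at_cat[C /code_at_cons[Pj _]]].
  rewrite size_compile in Pj.
  rewrite run_add (run_step _ _ _ Pl) /= (negPf rx).
  rewrite (R _ _ C) (run_step _ _ _ Pj) /run /=; congr Config; lia.
by apply: agree_sub A => y; rewrite /= mem_cat => ->.
Qed.

(** The counter descends: the body, run with [x] equal to [j], takes the invariant from [j.+1] to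
    [j]. A round pays 3 steps for test, decrement and jump back; the remaining 2 are the
    initialisation and the final test. *)
Lemma wp_for x b c T (I : nat -> (nat -> nat) -> (nat -> nat) -> Prop)
    (Q : _ -> _ -> Prop) N T' r m :
  r 1 = 0 -> r 2 = 1 -> r b = N -> x \notin [:: 1; 2] ->
  ~~ has [in [:: 1; 2; x]] (mods c) ->
  I N (upd r x N) m ->
  (forall j r1 m1, j < N -> agree (x :: mods c) r r1 -> I j.+1 r1 m1 ->
     wp c T (I j) (upd r1 x j) m1) ->
  (forall r1 m1, agree (x :: mods c) r r1 -> I 0 r1 m1 -> Q r1 m1) ->
  2 + N * (T + 3) <= T' ->
  wp (For x b c) T' Q r m.
Proof.
move=> r1 r2 rb x12 /hasPn cmods I0 IS IQ leT.
have x1 : 1 \notin x :: mods c.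
  rewrite inE negb_or; move: x12; rewrite !inE negb_or eq_sym => /andP[-> _] /=.
  by apply/negP => /cmods.
have x2 : 2 \notin x :: mods c.
  rewrite inE negb_or; move: x12; rewrite !inE negb_or [x == 2]eq_sym.
  by move=> /andP[_ ->] /=; apply/negP => /cmods.
have xc : x \notin mods c by apply/negP => /cmods; rewrite !inE eqxx !orbT.
suff loop j r0 m0 : j <= N -> agree (x :: mods c) r r0 -> r0 x = j ->
    I j r0 m0 ->
    exists t r' m', [/\ t <= j * (T + 3) + 1,
      runs (While x (Op (Defs.Sub x x 2);; c)) t r0 m0 r' m',
      agree (x :: mods c) r r' & I 0 r' m'].
  have [||t [r' [m' [let' R A i0]]]] := loop N (upd r x N) m (leqnn N) _ _ I0.
  - by apply: agree_upd; rewrite ?inE ?eqxx.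
  - by rewrite /upd eqxx.
  apply: (@wp_seq 1 (N * (T + 3) + 1)); last by lia.
  apply: wp_op => //=; rewrite r1 rb subn0.
  exists t, r', m'; split=> //; last by apply: IQ.
  by move=> y yx; rewrite A // /upd; case: eqP yx => // ->; rewrite inE eqxx.
elim: j r0 m0 => [|j IH] r0 m0 leN A0 r0x Ij.
  exists 1, r0, m0; split=> // P l /= /code_at_cons[Pl _].
  by rewrite (run_step _ _ _ Pl) /run /= r0x /=; congr Config; lia.
have [t1 [r1' [m1 [le1 R1 A1 I1]]]] := IS j r0 m0 leN A0 Ij.
have A1x : agree (x :: mods c) r r1'.
  apply: agree_trans A0 _.
  apply: (agree_trans (r2 := upd r0 x j)); first by apply: agree_upd; rewrite ?inE ?eqxx.
  by apply: agree_sub A1 => y; rewrite inE orbC => ->.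
have [|t2 [r3 [m3 [le2 R2 A2 I2]]]] := IH r1' m1 (ltnW leN) A1x _ I1.
  by rewrite A1 // /upd eqxx.
exists (t1 + t2.+1).+2, r3, m3; split=> //; first by lia.
move=> P l C; have := C => /=.
case/code_at_cons=> Pl; rewrite -cat_cons.
case/code_at_cat=> /code_at_cons[Psub Cc] /code_at_cons[].
rewrite [size _]/= size_compile => Pj _.
rewrite (run_step _ _ _ Pl) /= r0x /= (run_step _ _ _ Psub) /=.
have -> : upd r0 x (r0 x - r0 2) = upd r0 x j.
  by rewrite r0x (A0 2) // r2 subn1.
rewrite addn1 in Cc; rewrite run_add (R1 _ _ Cc).
rewrite (_ : l.+2 + len c = l.+1 + (len c).+1); last lia.
by rewrite (run_step _ _ _ Pj); exact: R2.
Qed.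

End Wp.

(** * The algorithm *)

Definition mul_n (d y b : nat) : cmd :=
  Op (Const d 0);; For y b (Op (Add d d 0)).

(** At least one of the two truncated differences is zero, so their sum is the distance between the
    two values. *)
Definition if_differ (a b : nat) (c1 c2 : cmd) : cmd :=
  Op (Defs.Sub 15 a b);; Op (Defs.Sub 16 b a);; Op (Add 15 15 16);; If 15 c1 c2.

(* Register 0 holds n, register 3 its square and register 6 its successor; the
   label of [u] is in cell [n * n + u], and the extra cell [u = n] is ignored by
   [valid], so that flipping it does nothing.  Register 4 holds the number of
   vertices treated so far, and register 5 is 1 after a success. *)
Definition count_bad : cmd :=
  Op (Add 12 3 8);; Op (Read 12 12);; Op (Add 13 9 8);; Op (Read 13 13);;
  if_differ 7 8
    (if_differ 14 12 Skip (if_differ 13 14 (Op (Add 11 11 2)) Skip))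
    Skip.

(** Registers 7 and 8 run over [v] and [u]; 9 holds [n * v], 14 the label of [v], and 11 counts the
    bad partners of [v]. *)
Definition check : cmd :=
  Op (Const 5 1);;
  For 7 4 (
    mul_n 9 10 7;;
    Op (Add 14 3 7);; Op (Read 14 14);;
    Op (Const 11 0);;
    For 8 4 count_bad;;
    Op (Defs.Sub 11 11 2);;
    If 11 (Op (Const 5 0)) Skip).

Definition flip_label (x : nat) : cmd :=
  Op (Add 12 3 x);; Op (Read 13 12);; Op (Defs.Sub 13 2 13);; Op (Write 12 13).

(** Backtracking: each level flips one cell, recurses, and undoes the flip after a failure; after a
    success the remaining rounds idle. The counters of the levels are the registers from 20 on,
    distinct from all others in use. *)
Fixpoint search (k : nat) : cmd :=
  if k is k'.+1 then
    let x := k'.+4.+4.+4.+4.+4 in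
    Op (Const 5 0);;
    For x 6 (
      If 5 Skip (flip_label x;; search k';; If 5 Skip (flip_label x)))
  else check.

(** A failed stage leaves 0 in register 5, which disables all later stages. The last loop moves the
    labels to the output cells. *)
Definition main : cmd :=
  Op (Const 2 1);;
  mul_n 3 7 0;;
  Op (Add 6 0 2);;
  Op (Const 5 1);;
  For 19 0 (If 5 (Op (Add 4 4 2);; search 5) Skip);;
  For 7 0 (Op (Add 12 3 7);; Op (Read 13 12);; Op (Write 7 13));;
  Op (Defs.Sub 0 5 1).

Local Arguments search : simpl never.

(** * Correctness and running time of the algorithm *)

Section MainCorrect.
Variables (w n : nat) (E : rel nat).
Hypothesis w_large : n * n + n + 2 <= 2 ^ w.

Definition constants (r : nat -> nat) : Prop :=
  [/\ r 0 = n, r 1 = 0, r 2 = 1, r 3 = n * n & r 6 = n.+1].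

Definition represents (m : nat -> nat) (L : nat -> bool) : Prop :=
  (forall v u, v < n -> u < n -> m (n * v + u) = E v u) /\
  (forall u, u <= n -> m (n * n + u) = L u).

Lemma agree_constants ds r r' : ~~ has [in [:: 0; 1; 2; 3; 6]] ds ->
  agree ds r r' -> constants r -> constants r'.
Proof.
move=> /hasPn nds A [r0 r1 r2 r3 r6].
by split; rewrite A //; apply/negP => /nds.
Qed.

Lemma cell_lt v u : v < n -> u <= n -> n * v + u <= n * n.
Proof. by nia. Qed.

Lemma wp_mul_n d y b T r m : r 0 = n -> r 1 = 0 -> r 2 = 1 ->
  uniq [:: d; y; 0; 1; 2] -> b != d -> r b <= n -> 3 + 4 * n <= T ->
  wp w (mul_n d y b) T (fun r' m' => m' = m /\ r' d = n * r b) r m.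
Proof.
move=> r0 r1 r2; rewrite /= !inE !negb_or -!andbA.
move=> /and5P[dy d0 d1 d2 /and4P[y0 y1 y2 _]] bd bn leT.
apply: (@wp_seq _ 1 (2 + 4 * n)); last lia.
apply: wp_op => //=; rewrite mod0n.
(* Since the counter descends, [r b - j] additions have been made when it equals [j]. *)
apply: (wp_for (T := 1) (N := r b)
  (I := fun j r' m' => m' = m /\ r' d = n * (r b - j))).
- by rewrite /upd eq_sym (negPf d1).
- by rewrite /upd eq_sym (negPf d2).
- by rewrite /upd (negPf bd).
- by rewrite !inE negb_or y1.
- by rewrite /= !inE !negb_or d1 d2 dy.
- by rewrite /upd (negPf dy) eqxx; split=> //; nia.
- move=> j r' m' lt_j A [-> r'd]; apply: wp_op => //=; split=> //.
  rewrite /upd eqxx (negPf dy) [0 == y]eq_sym (negPf y0) r'd.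
  rewrite A; last by rewrite !inE negb_or ![0 == _]eq_sym y0.
  rewrite /upd [0 == d]eq_sym (negPf d0) r0 modn_small; nia.
- by move=> r' m' _ [-> ->]; rewrite subn0.
- by lia.
Qed.

Lemma wp_if_differ a b c1 c2 T Q r m :
  a != 15 -> b != 15 -> r a <= n -> r b <= n ->
  (forall r', agree [:: 15; 16] r r' -> r a != r b -> wp w c1 T Q r' m) ->
  (forall r', agree [:: 15; 16] r r' -> r a = r b -> wp w c2 T Q r' m) ->
  wp w (if_differ a b c1 c2) T.+2.+3 Q r m.
Proof.
move=> a15 b15 an bn W1 W2.
do 3![apply: wp_opseq => //=]; set r' := upd _ 15 _.
have A : agree [:: 15; 16] r r'.
  by move=> y; rewrite !inE negb_or /r' /upd => /andP[/negPf-> /negPf->].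
have r'15 : (r' 15 == 0) = (r a == r b).
  by rewrite /r' /upd /= (negPf a15) (negPf b15) modn_small; lia.
apply: wp_if => [|/eqP]; first by rewrite r'15; apply: W1.
by rewrite r'15 => /eqP; apply: W2.
Qed.

(** The three nested comparisons are the three conjuncts of [bad]. Time 20 is 4 steps of loading, 5
    for each comparison and 1 increment. *)
Lemma wp_count_bad L v u r m : constants r -> represents m L ->
  v < n -> u < n -> r 7 = v -> r 8 = u -> r 9 = n * v -> r 14 = L v ->
  r 11 <= n ->
  wp w count_bad 20 (fun r' m' => m' = m /\ r' 11 = r 11 + bad E L v u) r m.
Proof.
move=> [r0 r1 r2 r3 r6] [mE mL] vn un r7 r8 r9 r14 r11.
have vu := cell_lt vn (ltnW un).
do 4![apply: wp_opseq => //=]; rewrite /upd /= r3 r8 r9.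
rewrite !modn_small; [|lia|lia].
rewrite mE // mL; last exact: ltnW.
set q := (X in wp _ _ _ _ X _).
have [q2 q7 q8 q11] : [/\ q 2 = 1, q 7 = v, q 8 = u & q 11 = r 11] by [].
have [q12 q13 q14] : [/\ q 12 = L u, q 13 = E v u & q 14 = L v] by [].
have bn (x : bool) : x <= n by case: x; lia.
have eqbn (x y : bool) : (x = y :> nat) <-> x = y by case: x; case: y.
have neqbn (x y : bool) : (x != y :> nat) = (x != y) by case: x; case: y.
clearbody q; rewrite -q11 in r11 *.
rewrite /bad; apply: (@wp_if_differ _ _ _ _ 11) => //; try (rewrite ?q7 ?q8; lia).
  rewrite q7 q8 => r' A ->.
  apply: (@wp_if_differ _ _ _ _ 6) => //; rewrite !A // ?q12 ?q14 //.
    rewrite neqbn => r'' A' /negPf ->; apply: wp_skip.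
    by rewrite A' // A // addn0.
  move=> r'' A' /eqbn LE; rewrite LE eqxx.
  apply: (@wp_if_differ _ _ _ _ 1) => //; rewrite !A' // !A // ?q13 ?q14 ?LE //.
    rewrite neqbn => q' A'' ->; apply: wp_op => //=; split=> //.
    by rewrite /upd eqxx !A'' // !A' // !A // q2 modn_small; lia.
  by move=> q' A'' /eqbn->; apply: wp_skip; rewrite eqxx !A'' // !A' // !A // addn0.
move=> r' A; rewrite q7 q8 => ->; rewrite eqxx.
by apply: wp_skip; rewrite A // addn0.
Qed.

Lemma wp_check L i r m : constants r -> represents m L ->
  r 4 = i -> i <= n ->
  wp w check (60 * n.+1 ^ 2)
    (fun r' m' => m' = m /\ r' 5 = valid E i L) r m.
Proof.
move=> Cr Rm r4 le_in; have [r0 r1 r2 r3 r6] := Cr.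
apply: (@wp_seq _ 1 (2 + n * ((20 + 4 * n + (2 + n * 23)) + 3))); last by nia.
apply: wp_op => //=; rewrite modn_small; last lia.
(* The vertices already checked are those from [j] to [i - 1], as the loop descends; the inner loop
   counts over [u] in the same way. *)
apply: (wp_for (T := 20 + 4 * n + (2 + n * 23)) (N := i)
  (I := fun j r' m' => m' = m /\
    r' 5 = all (fun v => count (bad E L v) (iota 0 i) <= 1) (iota j (i - j)))) => //.
- by rewrite subnn.
- move=> v q m1 lt_vi A [{m1}-> q5].
  have vn : v < n by lia.
  have {A}Aq : agree (mods check) r q.
    apply: (@agree_trans _ _ (upd r 5 1)); first exact: agree_upd.
    by apply: agree_sub A; apply/allP.
  have q4 : q 4 = i by rewrite Aq.
  have {Aq}Cq : constants q by apply: agree_constants Aq Cr.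
  have [q0 q1 q2 q3 q6] := Cq.
  apply: (@wp_seq _ (3 + 4 * n) (17 + (2 + n * 23))); last lia.
  apply: wp_weaken (@wp_mul_n _ _ _ (3 + 4 * n) _ _ _ _ _ _ _ _ _) _ _ => //.
    by rewrite /upd /=; lia.
  rewrite [upd q _ _ 7]/= => p m1 A [{m1}-> p9].
  have p7 : p 7 = v by rewrite A.
  have p4 : p 4 = i by rewrite A.
  have {}q5 : p 5 = (all (fun v => count (bad E L v) (iota 0 i) <= 1)
      (iota v.+1 (i - v.+1))) by rewrite A.
  have {A q0 q1 q2 q3 q4 q6 Cq}Cp : constants p.
    by apply: agree_constants A _.
  have [p0 p1 p2 p3 p6] := Cp.
  do 3![apply: wp_opseq => //=]; rewrite mod0n.
  set q' := (X in wp _ _ _ _ X _).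
  have Cq' : constants q' by [].
  have q'14 : q' 14 = L v.
    by rewrite /q' /upd /= p3 p7 modn_small ?(Rm.2) //; lia.
  have [q'7 q'9 q'11] : [/\ q' 7 = v, q' 9 = n * v & q' 11 = 0] by [].
  have [q'4 q'5] : q' 4 = i /\ q' 5 = p 5 by [].
  rewrite q5 {q5} in q'5; clearbody q'; clear p p0 p1 p2 p3 p4 p6 p7 p9 Cp.
  have [q0 q1 q2 q3 q6] := Cq'.
  apply: (@wp_seq _ (2 + n * 23) 4); last lia.
  apply: (wp_for (T := 20) (N := i)
    (I := fun j r' m' => m' = m /\
       r' 11 = count (bad E L v) (iota j (i - j)))) => //.
  + by rewrite subnn.
  + move=> u p m1 lt_ui A [{m1}-> p11].
    have Cp : constants p by apply: agree_constants A _.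
    apply: wp_weaken (@wp_count_bad L v u _ _ _ _ _ _ _ _ _ _ _) _ _ => //;
      try by rewrite /upd /= ?A //; lia.
      by rewrite /upd /= p11; have := count_size (bad E L v) (iota u.+1 (i - u.+1)); rewrite size_iota; lia.
    move=> p' m' _ [-> ->]; split=> //.
    by rewrite /upd /= p11 -(subnSK lt_ui) /= addnC.
  + move=> p m1 A [{m1}-> p11]; rewrite subn0 in p11.
    have [p2 p5] : p 2 = 1 /\ p 5 = q' 5 by rewrite !A.
    (* The truncated difference of the count and 1 is nonzero exactly when [v] has at least two bad
       partners. *)
    rewrite -(subnSK lt_vi) /= leqNgt -p11 -subn_gt0.
    apply: wp_opseq => //=; rewrite p2; apply: wp_if; rewrite /upd /= => H.
      by apply: wp_op; rewrite //= mod0n /upd /= lt0n H.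
    by apply: wp_skip; rewrite /= H p5 q'5.
  + by nia.
- by move=> p m1 _ [-> ->]; rewrite subn0.
- by nia.
Qed.

Lemma wp_flip_label x L a r m : constants r -> represents m L ->
  r x = a -> a <= n -> x \notin [:: 12; 13] ->
  wp w (flip_label x) 4 (fun r' m' => represents m' (flip L a)) r m.
Proof.
move=> [r0 r1 r2 r3 r6] [mE mL] rx an; rewrite !inE negb_or => /andP[x12 x13].
do 3![apply: wp_opseq => //=]; apply: wp_op => //=.
rewrite {-2}/upd /= r2 /upd /= r3 rx modn_small; last lia.
rewrite mL //; split=> [v u vn un|u un].
  rewrite (_ : _ == _ = false) ?mE //; nia.
by rewrite eqn_add2l mL // /flip; case: (u =P a) => [->|_]; case: (L _).
Qed.

(** Needed because flipping twice gives back [L] only pointwise. *)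
Lemma represents_ext m L L' :
  L =1 L' -> represents m L -> represents m L'.
Proof. by move=> eqL [mE mL]; split=> // u un; rewrite mL ?eqL. Qed.

Lemma flipK L a : flip (flip L a) a =1 L.
Proof. by move=> u; rewrite /flip -addbA addbb addbF. Qed.

(** Shows that a recursive call preserves the constants, register 4 and the counter [k + 20] of the
    enclosing loop. *)
Lemma mods_search k :
  {subset mods (search k) <= [pred y | (y == 5) || (6 < y < k.+4.+4.+4.+4.+4)]}.
Proof.
elim: k => [|k IH] /=; first exact/allP.
apply/allP; rewrite /= all_cat /= andbT !inE /= !ltnSn.
by apply/allP => y /IH; rewrite !inE => /orP[->//|/andP[-> /ltnW]]; rewrite ltnS orbC => ->.
Qed.

(** [P] describes the tuples tried so far, so that the same predicate is both the postcondition of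
    [search] and its loop invariant. A failure restores [L]. *)
Definition searched i L (P : seq nat -> bool) r m : Prop :=
  (exists L', [/\ r 5 = 1, represents m L' & valid E i L']) \/
  [/\ r 5 = 0, represents m L &
      forall s, P s -> all (fun a => a <= n) s -> ~~ valid E i (flips L s)].

(** Besides its recursive call, a round costs at most 15: two flips of 4, two tests of 2 and 3 for
    the loop. With 3 steps of setup, [n.+1] rounds add at most [18 * n.+1]. *)
Lemma wp_search k L i r m : constants r -> represents m L ->
  r 4 = i -> i <= n ->
  wp w (search k) ((60 + 18 * k) * n.+1 ^ k.+2)
    (searched i L (fun s => size s == k)) r m.
Proof.
elim: k L r m => [|k IH] L r m Cr Rm r4 le_in.
  apply: wp_weaken (wp_check Cr Rm r4 le_in) _ _; first by rewrite muln0 addn0.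
  move=> r' m' _ [-> r'5]; rewrite /searched r'5.
  case V: (valid E i L); [left; exists L => // | right; split=> // s].
  by move=> /nilP->; rewrite /= V.
have [r0 r1 r2 r3 r6] := Cr.
rewrite /search -/search; set x := k.+4.+4.+4.+4.+4.
set Tk := (60 + 18 * k) * n.+1 ^ k.+2 in IH.
apply: (@wp_seq _ 1 (2 + n.+1 * (Tk + 12 + 3))); last first.
  have : n.+1 <= n.+1 ^ k.+3 by rewrite (expnS _ k.+2) leq_pmulr ?expn_gt0.
  rewrite /Tk !(expnS _ k.+2); move: (n.+1 ^ k.+2) => p; nia.
apply: wp_op => //=; rewrite mod0n.
have modsP c : c = If 5 Skip (flip_label x;; search k;; If 5 Skip (flip_label x)) ->
    {subset mods c <= [pred y | (y == 5) || (6 < y < x)]}.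
  by move=> ->; apply/allP; rewrite /= all_cat andbT; apply/allP => y /mods_search.
apply: (wp_for (T := (Tk + 10).+2) (N := n.+1)
  (I := fun j => searched i L (fun s =>
     if s is a :: s' then (j <= a) && (size s' == k) else false))) => //.
- by apply/hasPn => y /modsP-/(_ erefl); rewrite !inE; lia.
- right; split=> // -[|a s] // /andP[lt_na _] /= /andP[]; lia.
- move=> j q m1 lt_jn A [[L' [q5 Rm1 V]]|[q5 Rm1 nV]].
    apply: wp_if; rewrite /upd /= q5 // => _.
    by apply: wp_skip; left; exists L'.
  apply: wp_if; rewrite /upd /= q5 // => _; rewrite -/(upd q x j).
  have Aq y : y \in [:: 0; 1; 2; 3; 4; 6] -> upd q x j y = r y.
    move=> y_in; have [y_x y5] : y < x /\ (y != 5) && ~~ (6 < y).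
      by move: y_in; rewrite !inE /x; lia.
    rewrite /upd ltn_eqF // A /upd; first by rewrite (negPf (andP y5).1).
    by rewrite inE ltn_eqF //; apply/negP => /modsP-/(_ erefl); rewrite inE; lia.
  have qx : upd q x j x = j by rewrite /upd eqxx.
  have Cq : constants (upd q x j) by split; rewrite Aq.
  have {}Aq : upd q x j 4 = i by rewrite Aq //.
  move: (upd q x j) qx Cq Aq => {}q qx Cq q4 {A q5}.
  apply: (@wp_seq _ 4 (Tk + 6)); last lia.
  apply: wp_weaken (wp_flip_label (L := L) Cq Rm1 qx _ _) _ _ => //.
  move=> q1 m2 A1 Rm2.
  have Cq1 : constants q1 by apply: agree_constants A1 Cq.
  have {}q4 : q1 4 = i by rewrite A1.
  have {}qx : q1 x = j by rewrite A1.
  apply: (@wp_seq _ Tk 6) => //; apply: wp_weaken (IH _ _ _ Cq1 Rm2 q4 _) _ _ => //.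
  move=> {m1 Rm1} q2 m1 A2 [[L' [q5 Rm1 V]]|[q5 Rm1 nV']].
    apply: wp_if; rewrite q5 // => _.
    by apply: wp_skip; left; exists L'.
  apply: wp_if; rewrite q5 // => _.
  have Cq2 : constants q2.
    apply: agree_constants A2 Cq1; apply/hasPn => y /mods_search.
    by rewrite !inE; lia.
  have {}qx : q2 x = j.
    by rewrite A2 //; apply/negP => /mods_search; rewrite inE ltnn andbF orbF.
  apply: wp_weaken (wp_flip_label Cq2 Rm1 qx _ _) _ _ => //.
  move=> q3 m3 A3 Rm3; right; split; first by rewrite A3.
    by apply: represents_ext Rm3; exact: flipK.
  move=> [|a s] //= /andP[le_ja sk] /andP[an sn].
  (* Tuples with head above [j] were excluded by earlier rounds, those with head [j] by the
     recursive call on [flip L j]. *)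
  have [lt_ja|] := ltnP j a; first by apply: (nV (a :: s)) => /=; rewrite ?an ?lt_ja.
  by move=> le_aj; have -> : a = j by [lia]; apply: nV'.
- move=> q m1 _ [[L' S]|[q5 Rm1 nV]]; [by left; exists L'|right; split=> //].
  by move=> [|a s] // sk; apply: nV; rewrite /= -eqSS.
- by rewrite !addnS addn0.
Qed.

Hypothesis E_sym : symmetric E.

Definition solved (r m : nat -> nat) : Prop :=
  (exists L : nat -> bool, [/\ r 0 = 1, forall v, v < n -> m v = L v & valid E n L]) \/
  (r 0 = 0 /\ ~ exists L, valid E n L).

Lemma wp_main r m : r 0 = n -> (forall x, x != 0 -> r x = 0) ->
  represents m (fun=> false) ->
  wp w main (200 * n.+1 ^ 8) solved r m.
Proof.
move=> r0 rx Rm.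
(* Time of one stage: five nested loops around a quadratic check, plus a few steps. *)
pose Tl := (3 + (60 + 18 * 5) * n.+1 ^ 7) .+2.
apply: (@wp_seq _ 1 (9 + 4 * n + (2 + n * (Tl + 3)) + (2 + n * 6))); last first.
  have : 0 < n.+1 ^ 7 by rewrite expn_gt0.
  rewrite /Tl (expnS _ 7); move: (n.+1 ^ 7) => p; nia.
apply: wp_op => //=; rewrite modn_small; last by lia.
have [T1 T1E] : exists T1, T1 = (2 + n * (Tl + 3)) + (2 + n * 6) by eexists.
apply: (@wp_seq _ (3 + 4 * n) (T1 + 4).+2); last lia.
apply: wp_weaken (@wp_mul_n 3 7 0 (3 + 4 * n) _ _ _ _ _ _ _ _ _) _ _ => //.
- by rewrite /upd /= rx.
- by rewrite /upd /= r0.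
rewrite /upd /= r0 => r1 m1 A [{m1}-> r13].
have r10 : r1 0 = n by rewrite A.
have r12 : r1 2 = 1 by rewrite A.
do 2![apply: wp_opseq => //=]; rewrite r10 r12 !modn_small; [|lia|lia].
set q := (X in wp _ _ _ _ X _).
have Cq : constants q.
  by split; rewrite /q /upd //= ?addn1 // A //= rx.
have q4 : q 4 = 0 by rewrite /q /upd /= A ?rx.
have q5 : q 5 = 1 by [].
clearbody q; clear r1 r10 r12 r13 A r r0 rx; have [q0 q1 q2 q3 q6] := Cq.
apply: (@wp_seq _ (2 + n * (Tl + 3)) (4 + (2 + n * 6))); last lia.
(* After [n - j] stages, either the first [n - j] vertices are validly labelled or the whole graph
   is known to have no valid labelling. *)
apply: (wp_for (T := Tl) (N := n) (I := fun j r m =>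
  (exists L, [/\ r 5 = 1, r 4 = n - j, represents m L & valid E (n - j) L]) \/
  (r 5 = 0 /\ ~ exists L, valid E n L))) => //.
- by left; exists (fun=> false); rewrite subnn.
- move=> j r m1 lt_jn A [[L [r5 r4 Rm1 V]]|[r5 nV]]; last first.
    by apply: wp_if; rewrite /upd /= r5 // => _; apply: wp_skip; right.
  apply: wp_if; rewrite /upd /= r5 // => _.
  have Cr : constants r by apply: agree_constants A Cq.
  have [_ _ r2 _ _] := Cr.
  apply: wp_opseq => //=.
  rewrite /upd /= r4 r2 modn_small addn1 subnSK //; last lia.
  apply: wp_weaken (@wp_search 5 L (n - j) _ _ _ _ _ _) _ _ => //; try lia.
  move=> r' m' A' [[L' [r'5 Rm' V']]|[r'5 Rm' nV]].
    by left; exists L'; split=> //; rewrite A'.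
  (* A valid labelling of the whole graph would provide five flips that the search has just
     excluded. *)
  right; split=> // exV; have lt_in : n - j.+1 < n by lia.
  have [s [s5 sn]] := valid_extend E_sym lt_in V exV.
  by rewrite subnSK //; apply/negP/nV; rewrite ?s5.
move=> r m1 A S.
have [r0 r1 r2 r3 r6] : constants r by apply: agree_constants A Cq.
apply: (@wp_seq _ (2 + n * 6) 1); last lia.
(* Targets lie below [n] and sources at [n * n] or above, so no label is overwritten before it is
   read. *)
apply: (wp_for (T := 3) (N := n) (I := fun j r m =>
  (exists L : nat -> bool, [/\ r 5 = 1, forall v, v < n -> m (n * n + v) = L v,
                 forall v, j <= v < n -> m v = L v & valid E n L]) \/
  (r 5 = 0 /\ ~ exists L, valid E n L))) => //.
- rewrite /upd /=; case: S => [[L [r5 _ [_ mL] V]]|]; [left|by right].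
  rewrite subn0 in V; exists L; split=> // [v /ltnW /mL //|v]; lia.
- move=> j p m2 lt_jn B S'.
  do 2![apply: wp_opseq => //=]; apply: wp_op => //=.
  rewrite /upd /= (B 3) // r3 modn_small; last lia.
  case: S' => [[L [p5 mL mL' V]]|]; [left|by right].
  exists L; split=> // v; first by move=> vn; rewrite gtn_eqF ?mL //; nia.
  by case: eqP => [->|/eqP vj] jv; [apply: mL|apply: mL'; lia].
- move=> p m2 B S'; apply: wp_op => //=.
  rewrite /solved /upd /= (B 1) // r1 subn0.
  by case: S' => [[L [p5 _ mL V]]|[p5 nV]]; [left; exists L|right].
Qed.

End MainCorrect.

(** * From labellings to MT-partitions *)

Section Correct.
Variables (n : nat) (e : rel 'I_n).

Definition nat_rel : rel nat := fun a b =>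
  [exists i : 'I_n, exists j : 'I_n, [&& i == a :> nat, j == b :> nat & e i j]].

Definition label (A : {set 'I_n}) (a : nat) : bool :=
  [exists i in A, i == a :> nat].

Lemma nat_relE (i j : 'I_n) : nat_rel i j = e i j.
Proof.
apply/existsP/idP => [[i' /existsP[j' /and3P[/eqP/val_inj-> /eqP/val_inj->]]]|eij] //.
by exists i; apply/existsP; exists j; rewrite !eqxx.
Qed.

Lemma labelE A (i : 'I_n) : label A i = (i \in A).
Proof.
apply/existsP/idP => [[j /andP[jA /eqP/val_inj<-]] //|iA].
by exists i; rewrite iA eqxx.
Qed.

Lemma nat_rel_sym : symmetric e -> symmetric nat_rel.
Proof.
move=> e_sym; suff sub a b : nat_rel a b -> nat_rel b a.
  by move=> a b; apply/idP/idP; apply: sub.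
case/existsP=> i /existsP[j /and3P[ia jb eij]].
by apply/existsP; exists j; apply/existsP; exists i; rewrite ia jb e_sym.
Qed.

(** Division with remainder by [n] recovers both endpoints from an address. Cells from [n * n] on
    are zero, so the initial labels are all [false]. *)
Lemma represents_input :
  represents n nat_rel (Defs.mem (graph_input e)) (fun=> false).
Proof.
split=> [v u vn un|u un]; rewrite [LHS]/=.
  congr nat_of_bool.
  apply: eq_existsb => i; apply: eq_existsb => j; rewrite andbA; congr (_ && _).
  rewrite mulnC (eq_sym (val i)) (eq_sym (val j)); apply/eqP/andP => [E|[/eqP-> /eqP->//]].
  have := (congr1 (divn^~ n) E, congr1 (modn^~ n) E); have n0 : 0 < n by lia.
  by rewrite !divnMDl // !modnMDl !divn_small // !modn_small // !addn0 => -[/= -> ->].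
apply/eqP; rewrite eqb0; apply/existsP => -[i /existsP[j /andP[/eqP E _]]].
by have := leq_mul (ltn_ord i) (leqnn n); have := ltn_ord j; rewrite mulSn; lia.
Qed.

Lemma MT_partitionC A B : MT_partition e A B -> B = ~: A.
Proof.
case/and4P=> /eqP AB dAB _ _; apply/setP => v; rewrite inE.
have : v \in A :|: B by rewrite AB inE.
by rewrite inE; case vA: (v \in A); rewrite ?(disjointFr dAB vA).
Qed.

Lemma MT_partition_valid A : irreflexive e ->
  MT_partition e A (~: A) = valid nat_rel n (label A).
Proof.
move=> e_irr; rewrite /MT_partition setUCr eqxx -setI_eq0 setICr eqxx /=.
have cnt (v : 'I_n) : count (bad nat_rel (label A) v) (iota 0 n) =
    #|[set u : 'I_n | [&& v != u, (v \in A) == (u \in A) & e v u != (v \in A)]]|.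
  rewrite cardsE cardE size_filter -enumT -val_enum_ord count_map.
  by apply: eq_count => u; rewrite /= /bad nat_relE !labelE.
have valP : valid nat_rel n (label A) =
    [forall v : 'I_n, count (bad nat_rel (label A) v) (iota 0 n) <= 1].
  apply/allP/forallP => [V v|V v]; first by apply: V; rewrite mem_iota /=.
  by rewrite mem_iota => /andP[_ vn]; apply: (V (Ordinal vn)).
rewrite valP; suff eqv (v : 'I_n) : (count (bad nat_rel (label A) v) (iota 0 n) <= 1) =
    ((v \in A) ==> (#|A| - 2 <= deg_in e A v)) &&
    ((v \in ~: A) ==> (deg_in e (~: A) v <= 1)).
  apply/andP/forallP => [[/forallP VA /forallP VB] v|V].
    by rewrite eqv VA VB.
  by split; apply/forallP => v; have := V v; rewrite eqv => /andP[].
rewrite cnt inE; case vA: (v \in A); rewrite /= ?andbT.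
  (* For [v] in A, the size of A is 1 plus the degree of [v] in A plus its number of bad partners,
     so the degree condition says that this number is at most 1. *)
  rewrite (cardsD1 v A) vA -(cardsID [set u | e v u] (A :\ v)) /deg_in.
  set X := #|[set u in A | e v u]|; set S := #|[set u | _]|.
  have -> : #|(A :\ v) :&: [set u | e v u]| = X.
    by apply: eq_card => u; rewrite !inE; case: eqP => // ->; rewrite e_irr !andbF.
  have -> : #|(A :\ v) :\: [set u | e v u]| = S.
    apply: eq_card => u; rewrite !inE eq_sym.
    by case: (v == u); case: (u \in A); case: (e v u).
  lia.
congr (_ <= _); apply: eq_card => u; rewrite !inE.
case: (v =P u) => [->|_] /=; first by rewrite e_irr andbF.
by case: (u \in A); case: (e v u).
Qed.

Lemma exec_main w : symmetric e -> n * n + n + 2 <= 2 ^ w -> irreflexive e ->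
  let c := run w (compile 0 main) (200 * n.+1 ^ 8) (graph_input e) in
  halted (compile 0 main) c /\ MT_output e c.
Proof.
move=> e_sym w_large e_irr.
have [//|x x0|t [r [m [le_t R _ S]]]] := wp_main w_large (nat_rel_sym e_sym)
  (r := upd (fun=> 0) 0 n) _ _ represents_input.
  by rewrite /upd (negPf x0).
set P := compile 0 main.
have run_t : run w P t (graph_input e) = Config (size P) r m.
  by rewrite size_compile R //; exists [::], [::]; rewrite cats0.
rewrite -(subnKC le_t) run_add run_t run_halted; last exact: leqnn.
split; first exact: leqnn.
have MTvalid : maya_tupi e <-> exists L, valid nat_rel n L.
  split=> [[A [B AB]]|[L V]].
    by exists (label A); rewrite -MT_partition_valid // -(MT_partitionC AB).
  exists [set v : 'I_n | L v], (~: [set v : 'I_n | L v]).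
  rewrite MT_partition_valid // (@eq_valid _ _ _ L) // => u un.
  by rewrite (labelE _ (Ordinal un)) inE.
rewrite /MT_output [reg _ 0]/=; case: S => [[L [-> mL V]]|[-> nV]]; last first.
  by split=> // /MTvalid.
split=> [//|[]|_]; first by apply/MTvalid; exists L.
(* The output cells hold booleans, hence only 0 or 1. *)
rewrite (_ : out_class n _ 0 = ~: out_class n (Config (size P) r m) 1); last first.
  by apply/setP => v; rewrite !inE /= mL //; case: (L v).
rewrite MT_partition_valid // (@eq_valid _ _ _ L) // => u un.
by rewrite (labelE _ (Ordinal un)) inE /= mL //; case: (L u).
Qed.

End Correct.

Theorem proposition3p2 :
  exists (P : program) (k : nat) (T : nat -> nat),
    bigO T (fun n => n ^ 8) /\
    forall (n : nat) (e : rel 'I_n), symmetric e -> irreflexive e ->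
      let c := run (word_length k n) P (T n) (graph_input e) in
      halted P c /\ MT_output e c.
Proof.
exists (compile 0 main), 4, (fun n => 200 * n.+1 ^ 8); split.
  (* From [n = 1] on, [n.+1] is at most [2 * n]; hence the factor [2 ^ 8]. *)
  exists (200 * 2 ^ 8), 1 => n n1.
  by rewrite -mulnA -expnMn leq_mul2l leq_exp2r //; lia.
move=> n e e_sym e_irr; apply: exec_main => //.
(* With 4 times the bit length, [2 ^ w] is the fourth power of [b]. As [b] is at least 2 and exceeds
   [n], it is at least [4 * n.+1 ^ 2], which leaves room for all addresses and sums. *)
rewrite /word_length mulnC expnM; set b := 2 ^ _.
have b_n : n < b by rewrite trunc_log_ltn.
have b2 : 2 <= b by rewrite (@leq_exp2l 2 1).
rewrite (expnM b 2 2) -!mulnn.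
by apply: leq_trans (leq_mul (leq_mul b2 b2) (leq_mul b_n b_n)); nia.
Qed.
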